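(* Let $n\ge2$ and let $Z_1=\{z_{j,1}\}_{j=1}^n$ and $Z_2=\{z_{j,2}\}_{j=1}^{n-1}$ be subsets of the unit circle with no common points, $z_{j,l}=e^{ix_{j,l}}$, where $$x_{1,1}<x_{1,2}<x_{2,1}<x_{2,2}<\dots<x_{n-1,1}<x_{n-1,2}<x_{n,1}<x_{1,1}+2\pi.$$ Let $\zeta=e^{ix}$ with $x_{n,1}<x<x_{1,1}+2\pi$ be an arbitrary point of the open arc from $z_{n,1}$ to $z_{1,1}$. Then there is a unique pair of finite CMV matrices $\mathcal{C}_1=\mathcal{C}(\alpha_0,\dots,\alpha_{n-3},\alpha_{n-2};\beta_1)$ of order $n$ and $\mathcal{C}_2=\mathcal{C}(\alpha_0,\dots,\alpha_{n-3};\beta_2)$ of order $n-1$ (with $|\alpha_j|<1$, $|\beta_1|=|\beta_2|=1$) such that the set of eigenvalues of $\mathcal{C}_l$ equals $Z_l$ for $l=1,2$ and $$\zeta=B:=\bar\beta_1\beta_2\,\frac{1-\bar\beta_2\alpha_{n-2}}{1-\beta_2\bar\alpha_{n-2}}.$$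
   Context: For $\alpha\in\mathbb{C}$ with $|\alpha|\le 1$ put $\rho=\sqrt{1-|\alpha|^2}$ and $\Theta(\alpha)=\begin{pmatrix}\bar\alpha&\rho\\ \rho&-\alpha\end{pmatrix}$. Given $N\ge1$, $\alpha_0,\dots,\alpha_{N-2}$ with $|\alpha_j|<1$ and $\beta$ with $|\beta|=1$, the finite CMV matrix $\mathcal{C}(\alpha_0,\dots,\alpha_{N-2};\beta)$ of order $N$ is the $N\times N$ matrix $\mathcal{L}\mathcal{M}$, where: if $N=2k+1$, $\mathcal{L}=\Theta(\alpha_0)\oplus\Theta(\alpha_2)\oplus\cdots\oplus\Theta(\alpha_{2k-2})\oplus\bar\beta$ and $\mathcal{M}=1\oplus\Theta(\alpha_1)\oplus\cdots\oplus\Theta(\alpha_{2k-1})$; if $N=2k$, $\mathcal{L}=\Theta(\alpha_0)\oplus\Theta(\alpha_2)\oplus\cdots\oplus\Theta(\alpha_{2k-2})$ and $\mathcal{M}=1\oplus\Theta(\alpha_1)\oplus\cdots\oplus\Theta(\alpha_{2k-3})\oplus\bar\beta$ ($1$ and $\bar\beta$ are $1\times1$ blocks; for $N=1$ the matrix is $(\bar\beta)$). *)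

(* Defs.v *)
From mathcomp Require Import all_boot all_algebra.
From mathcomp Require Import reals trigo complex.
Set Implicit Arguments. Unset Strict Implicit. Unset Printing Implicit Defensive.
Import GRing.Theory Num.Theory.
Local Open Scope ring_scope.

Section CMV.
Variable R : realType.
Local Notation C := R[i].

Definition expi (x : R) : C := (cos x +i* sin x)%C.

Definition rho (a : C) : C := sqrtC (1 - `|a| ^+ 2).

Definition theta_entry (a : C) (r c : nat) : C :=
  match r, c with
  | 0, 0 => Num.conj a
  | 0, _ => rho a
  | _, 0 => rho a
  | _, _ => - a
  end.

(* Block-diagonal matrix of order N built from 2x2 blocks Theta(alpha_s)
   on the index pairs (s, s+1) with s = p (mod 2):
   - p = 0 : L = Theta(a0) (+) Theta(a2) (+) ... [(+) conj beta if N odd]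
   - p = 1 : M = 1 (+) Theta(a1) (+) Theta(a3) (+) ... [(+) conj beta if N even]
   For index i, put u := i + p, q := u %/ 2; the pair containing i starts at
   s = 2q - p (when p <= 2q) and is a genuine 2x2 block iff s + 1 < N.
   Remaining 1x1 blocks: the leading 1 of M (i < p) and the trailing conj beta. *)
Definition cmv_block (p N : nat) (alpha : nat -> C) (beta : C) : 'M[C]_N :=
  \matrix_(i < N, j < N)
    let q := ((i + p) %/ 2)%N in
    let s := (q.*2 - p)%N in
    if [&& ((i + p) %/ 2 == (j + p) %/ 2)%N, (p <= q.*2)%N & (s.+1 < N)%N]
    then theta_entry (alpha s) ((i + p) %% 2) ((j + p) %% 2)
    else if i == j :> nat then (if (i < p)%N then 1 else Num.conj beta)
    else 0.

Definition cmvL N alpha beta := cmv_block 0 N alpha beta.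
Definition cmvM N alpha beta := cmv_block 1 N alpha beta.

Definition cmv (N : nat) (alpha : nat -> C) (beta : C) : 'M[C]_N :=
  cmvL N alpha beta *m cmvM N alpha beta.

Definition cmvB (n : nat) (alpha : nat -> C) (beta1 beta2 : C) : C :=
  Num.conj beta1 * beta2 * (1 - Num.conj beta2 * alpha (n - 2)%N)
    / (1 - beta2 * Num.conj (alpha (n - 2)%N)).

Definition cmv_pair_ok (n : nat) (x1 x2 : nat -> R) (zeta : C)
    (D1 : 'M[C]_n) (D2 : 'M[C]_(n.-1)) : Prop :=
  exists (alpha : nat -> C) (b1 b2 : C),
    [/\ (forall j, (j < n.-1)%N -> `|alpha j| < 1) /\
        `|b1| = 1 /\ `|b2| = 1,
        D1 = cmv n alpha b1 /\ D2 = cmv n.-1 alpha b2,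
        (forall z : C, eigenvalue D1 z <->
            exists2 j, (1 <= j <= n)%N & z = expi (x1 j)),
        (forall z : C, eigenvalue D2 z <->
            exists2 j, (1 <= j <= n.-1)%N & z = expi (x2 j)) &
        zeta = cmvB n alpha b1 b2].

End CMV.

(* Main.v *)
(* Write Phi, Phi* for the Szego pair of degree n-2. Eliminating the first
   component, the Szego recursion shows that the spectra of C_1 and C_2 are the zero
   sets of polynomials p1, p2 related by
     p1 = (X + conj b1 * al) * p2 + conj b2 * (1 - b2 * conj al) * (X - B) * Phi*,
   where al = alpha_(n-2).  Evaluation at B = zeta gives al, then the identity gives
   Phi*, hence Phi and the remaining coefficients: this is uniqueness.
   For existence let y_j run through Z_2 and zeta.  Interlacing says that p1(y_j)
   equals 2 k r_j y_j prod_(i <> j) (y_j - y_i) with r_j > 0 and k a fixed unimodular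
   number; the weights proportional to r_j on Z_2 define a probability measure whose
   monic orthogonal polynomial is Phi, and 2 sum_j r_j = 2 Re k (with zeta included)
   forces |al| < 1. *)
Require Import Defs.
From mathcomp Require Import all_boot all_order all_algebra.
From mathcomp Require Import reals trigo complex.
From mathcomp Require Import zify ring lra.
Set Implicit Arguments. Unset Strict Implicit. Unset Printing Implicit Defensive.
Import Order.TTheory GRing.Theory Num.Theory.
Local Open Scope ring_scope.

(** * Szego recursion *)

Section Szego.
Variable C : numClosedFieldType.
Implicit Types (a : nat -> C) (b z : C) (m : nat).

Fixpoint szego a m : {poly C} * {poly C} :=
  if m is k.+1 then
    let p := szego a k in
    ('X * p.1 - (a k)^* *: p.2, p.2 - a k *: ('X * p.1))
  else (1, 1).

(** The para-orthogonal polynomial of degree m+1, whose zeros turn out to be the spectrum of the CMV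
    matrix of order m+1. *)
Definition parapoly a b m : {poly C} := 'X * (szego a m).1 - b^* *: (szego a m).2.

End Szego.

Section Poly.
Variable F : fieldType.
Implicit Types (p q : {poly F}).

Lemma monic_roots_prod n (p : {poly F}) (z : 'I_n -> F) : injective z ->
  p \is monic -> size p = n.+1 -> (forall i, root p (z i)) ->
  p = \prod_(i < n) ('X - (z i)%:P).
Proof.
move=> z_inj /monicP p1 sp pz; set s := codom z.
have us : uniq s by rewrite map_inj_uniq ?enum_uniq.
have -> : \prod_(i < n) ('X - (z i)%:P) = \prod_(x <- s) ('X - x%:P).
  by rewrite big_image.
rewrite -[RHS]scale1r -p1; apply: all_roots_prod_XsubC; last by rewrite uniq_rootsE.
  by rewrite size_codom card_ord.
by apply/allP => _ /codomP[i ->].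
Qed.

Lemma poly_eq_points n (p q : {poly F}) (z : 'I_n -> F) : injective z ->
  (size (p - q)%R <= n)%N -> (forall i, p.[z i] = q.[z i]) -> p = q.
Proof.
move=> z_inj spq pqz; apply/eqP; rewrite -subr_eq0; apply/eqP.
apply: (@roots_geq_poly_eq0 _ _ (codom z)).
- by apply/allP => _ /codomP[i ->]; rewrite /root !hornerE pqz subrr.
- by rewrite map_inj_uniq ?enum_uniq.
- by rewrite size_codom card_ord.
Qed.

Lemma size_monic_sub n (p q : {poly F}) : p \is monic -> q \is monic ->
  size p = n.+1 -> size q = n.+1 -> (size (p - q)%R <= n)%N.
Proof.
move=> /monicP p1 /monicP q1 sp sq; apply/leq_sizeP => j nj; rewrite coefB.
have [jn|jn] := eqVneq j n.
  by move: p1 q1; rewrite /lead_coef sp sq jn /= => -> ->; rewrite subrr.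
by rewrite !nth_default ?subrr ?sp ?sq // ltn_neqAle eq_sym jn.
Qed.

End Poly.

Section SzegoTheory.
Variable C : numClosedFieldType.
Implicit Types (a : nat -> C) (b z : C) (m : nat) (A B : {poly C}).

Lemma monicXM_sub m A B c : A \is monic -> size A = m.+1 -> (size B <= m.+1)%N ->
  'X * A - c *: B \is monic /\ size ('X * A - c *: B)%R = m.+2.
Proof.
move=> A1 sA sB.
have sXA : size ('X * A)%R = m.+2 by rewrite mulrC size_mulX ?monic_neq0 ?sA.
have lt : (size (- (c *: B))%R < size ('X * A)%R)%N.
  by rewrite size_polyN sXA ltnS (leq_trans (size_scale_leq _ _)).
by split; rewrite ?size_polyDl // monicE lead_coefDl // lead_coef_Mmonic // lead_coefX.
Qed.

(** The degree of Phi* may drop, hence a mere bound; its value 1 at 0 allows coefficients to be read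
    off constant terms. *)
Lemma szego_props a m :
  [/\ (szego a m).1 \is monic, size (szego a m).1 = m.+1,
      (size (szego a m).2 <= m.+1)%N & (szego a m).2.[0] = 1].
Proof.
elim: m => [|m [IH1 IH2 IH3 IH4]] /=; first by rewrite monic1 size_poly1 hornerC.
have [m1 s1] := monicXM_sub (a m)^* IH1 IH2 IH3; split=> //; last first.
  by rewrite !hornerE IH4 /= ?(mul0r, mulr0, subr0).
rewrite (leq_trans (size_polyD _ _)) // geq_max size_polyN (leq_trans IH3) //.
by rewrite (leq_trans (size_scale_leq _ _)) // mulrC size_mulX ?monic_neq0 ?IH2.
Qed.

Lemma parapoly_monic a b m :
  parapoly a b m \is monic /\ size (parapoly a b m) = m.+2.
Proof. by have [? ? ? ?] := szego_props a m; apply: monicXM_sub. Qed.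

Lemma parapoly0 a b m : (parapoly a b m).[0] = - b^*.
Proof. by have [_ _ _ h] := szego_props a m; rewrite !hornerE h /=; ring. Qed.

Lemma eq_szego a a' m : (forall j, (j < m)%N -> a j = a' j) -> szego a m = szego a' m.
Proof.
by elim: m => // m IH aa' /=; rewrite aa' // IH // => j jm; apply: aa'; lia.
Qed.

Lemma normC_lt1_neq z : `|z| < 1 -> 1 - z * z^* != 0.
Proof. by move=> z1; rewrite -normCK gt_eqF // subr_gt0 expr_lt1. Qed.

(* As Phi*(0) = 1, the last coefficient is read off Phi(0), and the Szego step is
   invertible because its determinant 1 - |a m|^2 is nonzero. *)
Lemma szego_inj a a' m :
  (forall j, (j < m)%N -> `|a j| < 1) ->
  szego a m = szego a' m -> forall j, (j < m)%N -> a j = a' j.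
Proof.
elim: m => // m IH a1 /= -[E1 E2].
have am : a m = a' m.
  have [_ _ _ h] := szego_props a m; have [_ _ _ h'] := szego_props a' m.
  have := congr1 (fun p => p.[0]) E1; rewrite !hornerE h h' /= !(mul0r, mulr1, add0r).
  by move/oppr_inj/(can_inj conjCK).
have d0 := normC_lt1_neq (a1 m (ltnSn m)).
rewrite -am in E1 E2.
have {E1 E2} : szego a m = szego a' m.
  rewrite [LHS]surjective_pairing [RHS]surjective_pairing; congr pair.
    apply: (mulfI (monic_neq0 (monicX C))); apply: (scalerI d0).
    have -> : (1 - a m * (a m)^*) *: ('X * (szego a m).1) =
     ('X * (szego a m).1 - (a m)^* *: (szego a m).2) +
     (a m)^* *: ((szego a m).2 - a m *: ('X * (szego a m).1)).
      by rewrite -!mul_polyC; ring.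
    by rewrite E1 E2 -!mul_polyC; ring.
  apply: (scalerI d0).
  have -> : (1 - a m * (a m)^*) *: (szego a m).2 =
     a m *: ('X * (szego a m).1 - (a m)^* *: (szego a m).2) +
     ((szego a m).2 - a m *: ('X * (szego a m).1)).
    by rewrite -!mul_polyC; ring.
  by rewrite E1 E2 -!mul_polyC; ring.
move=> E j; rewrite ltnS leq_eqVlt => /predU1P[->//|jm].
by apply: IH => // i im; apply: a1; lia.
Qed.

(* The reversed polynomial A* of the Szego recursion, at degree m. *)
Definition revp m A : {poly C} := \poly_(i < m.+1) (A`_(m - i))^*.

(** In this form the reversal is multiplicative and can be computed factor by factor on products. *)
Lemma horner_revp m A z : (size A <= m.+1)%N -> z != 0 ->
  (revp m A).[z] = z ^+ m * (A.[(z^*)^-1])^*.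
Proof.
move=> sA z0; rewrite horner_poly (horner_coef_wide _ sA) rmorph_sum /= mulr_sumr.
rewrite (reindex_inj rev_ord_inj) /=; apply: eq_bigr => i _.
have im : (i <= m)%N by rewrite -ltnS.
rewrite subSS subKn // rmorphM /= rmorphXn /= fmorphV /= conjCK mulrCA; congr (_ * _).
by rewrite exprVn -expfB_cond ?(negPf z0) ?add0n // subnn.
Qed.

Lemma poly_eq_nonzero (A B : {poly C}) : (forall z, z != 0 -> A.[z] = B.[z]) -> A = B.
Proof.
move=> AB; set n := size (A - B)%R.
apply: (@poly_eq_points _ n _ _ (fun i : 'I_n => i.+1%:R)) => // [i j /eqP|i].
  by rewrite eqr_nat eqSS => /eqP/val_inj.
by apply: AB; rewrite pnatr_eq0.
Qed.

(** The difference of the squared moduli factors as (|z|^2 - 1)(1 - |x|^2). *)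
Lemma le_norm_blaschke (x z : C) : `|x| < 1 -> 1 <= `|z| -> `|1 - x^* * z| <= `|z - x|.
Proof.
move=> x1 z1; rewrite -(ler_pXn2r (n := 2)) ?nnegrE // !normCK.
rewrite !rmorphB !rmorphM /= conjCK rmorph1 -subr_ge0.
have -> : (z - x) * (z^* - x^*) - (1 - x^* * z) * (1 - x * z^*) =
  (z * z^* - 1) * (1 - x * x^*) by ring.
by rewrite -!normCK mulr_ge0 ?subr_ge0 ?exprn_ege1 // expr_le1 // ltW.
Qed.

Lemma monic_prod_roots m A : A \is monic -> size A = m.+1 ->
  exists x : 'I_m -> C, A = \prod_(i < m) ('X - (x i)%:P).
Proof.
move=> A1 sA; have [s As] := closed_field_poly_normal A.
have {}As : A = \prod_(x <- s) ('X - x%:P) by rewrite {1}As (monicP A1) scale1r.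
have ss : size s = m by apply/succn_inj; rewrite -sA As size_prod_XsubC.
by exists (fun i => s`_i); rewrite As (big_nth 0) ss big_mkord.
Qed.

(** The roots x_i of A lie in the open disc, and A* is the product of the factors 1 - conj(x_i) z,
    each bounded in modulus by |z - x_i|. *)
Lemma le_norm_revp m A z : A \is monic -> size A = m.+1 ->
  (forall z, 1 <= `|z| -> A.[z] != 0) -> 1 <= `|z| -> `|(revp m A).[z]| <= `|A.[z]|.
Proof.
move=> A1 sA nz z1; have z0 : z != 0 by rewrite -normr_gt0 (lt_le_trans _ z1).
have [x Ax] := monic_prod_roots A1 sA.
rewrite horner_revp ?sA // Ax !horner_prod rmorph_prod.
rewrite -[X in z ^+ X]card_ord -prodr_const -big_split /= !normr_prod.
apply: ler_prod => i _; rewrite normr_ge0 /= !hornerE rmorphB /= fmorphV /= conjCK.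
rewrite mulrBr divff // mulrC le_norm_blaschke // real_ltNge ?normr_real ?real1 //.
apply/negP => /nz; rewrite Ax horner_prod => /prodf_neq0 /(_ i isT).
by rewrite !hornerE subrr eqxx.
Qed.

(* Downward Szego step: al = - conj A(0) lies in the disc as A(0) is a product of
   roots up to sign, and |A*| being at most |A| outside the disc keeps the next polynomial
   zero-free there. *)
Lemma schur_cohn m A : A \is monic -> size A = m.+1 ->
  (forall z, 1 <= `|z| -> A.[z] != 0) ->
  exists2 a, (forall j, (j < m)%N -> `|a j| < 1) & szego a m = (A, revp m A).
Proof.
elim: m A => [|m IH] A A1 sA nz.
  exists (fun=> 0) => //=; have -> : A = 1.
    by rewrite (size1_polyC (eq_leq sA)) -[1]/(1%:P) -(monicP A1) /lead_coef sA.
  congr pair; apply/polyP => -[|i]; rewrite coef_poly ?coef1 ?subnn ?coef1 //= ?rmorph1 //.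
set B := revp m.+1 A; have [al alE] : exists al : C, al = - (A.[0])^* by eexists.
have Alead : A`_m.+1 = 1 by rewrite -(monicP A1) /lead_coef sA.
have coefB i : (i <= m.+1)%N -> B`_i = (A`_(m.+1 - i))^*.
  by move=> im; rewrite coef_poly ltnS im.
have sB : (size B <= m.+2)%N by exact: size_poly.
have al1 : `|al| < 1.
  have [x Ax] := monic_prod_roots A1 sA.
  have x1 i : `|x i| < 1.
    rewrite real_ltNge ?normr_real ?real1 //; apply/negP => /nz.
    rewrite Ax horner_prod => /prodf_neq0 /(_ i isT).
    by rewrite !hornerE subrr eqxx.
  rewrite alE normrN norm_conjC Ax horner_prod normr_prod big_ord_recl.
  rewrite !hornerE normrN (le_lt_trans _ (x1 ord0)) // ler_piMr // prodr_ile1 // => i _.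
  by rewrite normr_ge0 !hornerE normrN ltW.
have d0 := normC_lt1_neq al1; set d := 1 - al * al^* in d0.
have B0 : B.[0] = 1 by rewrite horner_coef0 coefB // subn0 Alead rmorph1.
(* Inverting the recursion: A + conj al B should be (1 - |al|^2) X A', and it vanishes at 0 by the
   choice of al. *)
pose T := d^-1 *: (A + al^* *: B).
have T0 : T.[0] = 0 by rewrite /T !hornerE B0 /= alE rmorphN /= conjCK; ring.
have /factor_theorem[A' TA'] : root T 0 by exact/rootP.
rewrite polyC0 subr0 mulrC in TA'.
have coefA' i : A'`_i = d^-1 * (A`_i.+1 + al^* * B`_i.+1).
  by have := coefXM A' i.+1; rewrite -TA' /= => <-; rewrite !coefE.
have AN0 : A`_0 = - al^* by rewrite alE rmorphN /= conjCK opprK horner_coef0.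
have sA' : size A' = m.+1.
  apply/eqP; rewrite eqn_leq; apply/andP; split.
    apply/leq_sizeP => j mj; rewrite coefA' !nth_default ?sA ?(leq_trans sB) //.
    by rewrite mulr0 addr0 mulr0.
  rewrite ltnNge; apply/negP => sA'; have := coefA' m.
  rewrite nth_default // Alead coefB // subnn AN0 rmorphN /= conjCK.
  move/eqP; rewrite eq_sym mulf_eq0 invr_eq0 (negPf d0) /=.
  by apply/negP; rewrite mulrN mulrC.
have A'1 : A' \is monic.
  rewrite monicE /lead_coef sA' /= coefA' Alead coefB // subnn AN0 rmorphN /= conjCK.
  by rewrite mulrN [_^* * _]mulrC mulVf.
have [z z1|a a1 Ea] := IH A' A'1 sA'.
  have : z * A'.[z] != 0.
    have -> : z * A'.[z] = T.[z] by rewrite TA' !hornerE.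
    rewrite /T !hornerE mulf_neq0 ?invr_eq0 // -normr_gt0.
    have : `|al^* * B.[z]| < `|A.[z]|.
      rewrite normrM norm_conjC; apply: (@le_lt_trans _ _ (`|al| * `|A.[z]|)).
        by rewrite ler_wpM2l // le_norm_revp.
      by rewrite gtr_pMl // normr_gt0 nz.
    rewrite -subr_gt0 => h; apply: (lt_le_trans h); exact: lerB_normD.
  by rewrite mulf_eq0 negb_or => /andP[].
pose a' j := if j == m then al else a j.
have a'm : a' m = al by rewrite /a' eqxx.
exists a' => [j jm|].
  rewrite /a'; case: eqVneq => // jm'; apply: a1; lia.
have revA' : d *: revp m A' = B + al *: A.
  apply/polyP => i; rewrite coefZ coefD coefZ [(revp _ _)`_i]coef_poly.
  case: ltnP => im; last first.
    (* At index m+1 the right side has coefficient conj A(0) + al, which is zero. *)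
    rewrite mulr0; have [->|im'] := eqVneq i m.+1.
      rewrite coefB // subnn AN0 Alead rmorphN /= conjCK; ring.
    have im2 : (m.+2 <= i)%N by lia.
    by rewrite !nth_default ?sA ?(leq_trans sB) //; ring.
  rewrite coefA' -subSn // coefB ?leq_subr // subKn; last by lia.
  rewrite rmorphM rmorphD rmorphM /= fmorphV /= !conjCK coefB; last by lia.
  have -> : d^* = d by rewrite /d rmorphB rmorph1 rmorphM /= conjCK mulrC.
  by rewrite mulrA divff // mul1r.
have XA' : d *: ('X * A') = A + al^* *: B by rewrite -TA' scalerA divff // scale1r.
rewrite /= a'm (eq_szego (a' := a)) ?Ea /=; last first.
  by move=> j jm; rewrite /a'; case: eqVneq => // jm'; lia.
congr pair; apply: (scalerI d0).
  have -> : d *: ('X * A' - al^* *: revp m A') = d *: ('X * A') - al^* *: (d *: revp m A').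
    by rewrite -!mul_polyC; ring.
  rewrite XA' revA' /d -!mul_polyC rmorphB rmorphM /=; ring.
have -> : d *: (revp m A' - al *: ('X * A')) = d *: revp m A' - al *: (d *: ('X * A')).
  by rewrite -!mul_polyC; ring.
rewrite XA' revA' /d -!mul_polyC rmorphB rmorphM /=; ring.
Qed.

End SzegoTheory.

(** * Reconstruction of the coefficients *)

Section Interpolation.
Variable F : fieldType.

Lemma horner_prod_cond (I : Type) (r : seq I) (P : pred I) (p : I -> {poly F}) x :
  (\prod_(i <- r | P i) p i).[x] = \prod_(i <- r | P i) (p i).[x].
Proof.
rewrite big_mkcond horner_prod [RHS]big_mkcond; apply: eq_bigr => i _.
by case: (P i); rewrite ?hornerC.
Qed.

Lemma prod_neq_XsubC n (z : 'I_n.+1 -> F) (j : 'I_n.+1) :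
  \prod_(i < n.+1 | i != j) ('X - (z i)%:P) \is monic /\
  size (\prod_(i < n.+1 | i != j) ('X - (z i)%:P))%R = n.+1.
Proof.
have m1 : \prod_(i < n.+1 | i != j) ('X - (z i)%:P) \is monic.
  by apply: monic_prod_XsubC.
split=> //; apply: succn_inj.
have := size_prod_XsubC (index_enum 'I_n.+1) z.
rewrite (bigD1 j) //= size_Mmonic ?polyXsubC_eq0 // size_XsubC => E.
by apply: etrans (E : (size _).+1 = _) _; rewrite /index_enum -enumT size_enum_ord.
Qed.

Lemma horner_prod_neq n (z : 'I_n.+1 -> F) (j k : 'I_n.+1) : k != j ->
  (\prod_(i < n.+1 | i != j) ('X - (z i)%:P)).[z k] = 0.
Proof. by move=> kj; rewrite horner_prod_cond (bigD1 k) //= !hornerE subrr mul0r. Qed.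

Lemma horner_sum_prod_neq n (z c : 'I_n.+1 -> F) (k : 'I_n.+1) :
  (\sum_(j < n.+1) c j *: \prod_(i < n.+1 | i != j) ('X - (z i)%:P)).[z k] =
  c k * \prod_(i < n.+1 | i != k) (z k - z i).
Proof.
rewrite horner_sum (bigD1 k) //= [X in _ + X]big1 ?addr0 => [|j jk].
  by rewrite hornerZ horner_prod_cond; congr (_ * _); apply: eq_bigr => i _; rewrite !hornerE.
by rewrite hornerZ horner_prod_neq ?mulr0 // eq_sym.
Qed.

Lemma monic_lagrange n (z c : 'I_n.+1 -> F) (p : {poly F}) :
  injective z -> p \is monic -> size p = n.+2 ->
  (forall j, p.[z j] = c j * \prod_(i < n.+1 | i != j) (z j - z i)) ->
  p = \prod_(i < n.+1) ('X - (z i)%:P) +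
      \sum_(j < n.+1) c j *: \prod_(i < n.+1 | i != j) ('X - (z i)%:P).
Proof.
move=> z_inj p1 sp pz; apply: (poly_eq_points z_inj) => [|k].
  rewrite opprD addrA (leq_trans (size_polyD _ _)) // geq_max size_polyN.
  rewrite size_monic_sub ?monic_prod_XsubC //=; last first.
    by rewrite size_prod_XsubC /index_enum -enumT size_enum_ord.
  rewrite (leq_trans (size_sum _ _ _)) //; apply/bigmax_leqP => j _.
  by rewrite (leq_trans (size_scale_leq _ _)) //; have [_ ->] := prod_neq_XsubC z j.
rewrite hornerD horner_sum_prod_neq pz.
have -> : (\prod_(i < n.+1) ('X - (z i)%:P)).[z k] = 0; last by rewrite add0r.
by rewrite (bigD1 k) //= hornerM hornerXsubC subrr mul0r.
Qed.

(** At 0 the extra factor z j completes each partial product to the full one, so the constant term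
    reveals the sum of the c j. *)
Lemma sum_lagrange_coef n (z c : 'I_n.+1 -> F) (p : {poly F}) :
  injective z -> p \is monic -> size p = n.+2 -> (forall j, z j != 0) ->
  (forall j, p.[z j] = c j * z j * \prod_(i < n.+1 | i != j) (z j - z i)) ->
  p.[0] = \prod_(i < n.+1) (- z i) * (1 - \sum_(j < n.+1) c j).
Proof.
move=> z_inj p1 sp z0 pz; rewrite (monic_lagrange z_inj p1 sp pz).
rewrite hornerD horner_prod_cond mulrBr mulr1; congr (_ + _).
  by apply: eq_bigr => i _; rewrite !hornerE.
rewrite horner_sum mulr_sumr -sumrN; apply: eq_bigr => j _.
rewrite hornerZ horner_prod_cond [X in _ = - (X * _)](bigD1 j) //=.
rewrite (eq_bigr (fun i => - z i)) => [|i _]; last by rewrite !hornerE.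
by ring.
Qed.

End Interpolation.

(** * Orthogonal and para-orthogonal polynomials of finite measures on the circle *)

Section OPUC.
Variable C : numClosedFieldType.
Implicit Types (a : nat -> C) (b : C).

Lemma norm1_conj (z : C) : `|z| = 1 -> z * z^* = 1.
Proof. by move=> z1; rewrite -normCK z1 expr1n. Qed.

Section Weights.
Variables (m : nat) (z w : 'I_m.+1 -> C).
Hypotheses (z_inj : injective z) (z1 : forall i, `|z i| = 1).
Hypotheses (w_gt0 : forall i, 0 < w i) (w_sum1 : \sum_i w i = 1).

(* The monic orthogonal polynomial of degree m of the measure with mass w j at z j. *)
Definition opuc := \sum_(j < m.+1) w j *: \prod_(i < m.+1 | i != j) ('X - (z i)%:P).

(* The unimodular boundary coefficient for which the para-orthogonal polynomial
   vanishes exactly at the z i, see [opuc_para]. *)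
Definition para_beta : C := - \prod_(i < m.+1) - (z i)^*.

Lemma opuc_monic : opuc \is monic /\ size opuc = m.+1.
Proof.
have s : (size opuc <= m.+1)%N.
  rewrite (leq_trans (size_sum _ _ _)) //; apply/bigmax_leqP => j _.
  by rewrite (leq_trans (size_scale_leq _ _)) //; have [_ ->] := prod_neq_XsubC z j.
have cm : opuc`_m = 1.
  rewrite coef_sum -w_sum1; apply: eq_bigr => j _; rewrite coefZ.
  have [/monicP + sj] := prod_neq_XsubC z j.
  by rewrite /lead_coef sj /= => ->; rewrite mulr1.
have {}s : size opuc = m.+1.
  apply/eqP; rewrite eqn_leq s ltnNge; apply/negP => sm.
  by move/eqP: cm; rewrite nth_default // eq_sym oner_eq0.
by rewrite monicE /lead_coef s /= cm.
Qed.

(* For |x| >= 1 outside the support every x / (x - z i) has positive real part. *)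
Lemma opuc_neq0 (x : C) : 1 <= `|x| -> opuc.[x] != 0.
Proof.
move=> x1.
have [/existsP[k /eqP ->]|/existsPn xz] := boolP [exists k, x == z k].
  rewrite horner_sum_prod_neq mulf_neq0 ?(gt_eqF (w_gt0 k)) //.
  by apply/prodf_neq0 => i ik; rewrite subr_eq0 (inj_eq z_inj) eq_sym.
have xz0 i : x - z i != 0 by rewrite subr_eq0.
apply/eqP => o0.
pose t i := x / (x - z i).
have st : \sum_i w i * t i = 0.
  have -> : \sum_i w i * t i = x / \prod_i (x - z i) * opuc.[x].
    rewrite horner_sum mulr_sumr; apply: eq_bigr => j _.
    rewrite hornerZ horner_prod_cond [X in _ / X](bigD1 j) //=.
    have -> : \prod_(i < m.+1 | i != j) ('X - (z i)%:P).[x] =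
        \prod_(i < m.+1 | i != j) (x - z i) by apply: eq_bigr => i _; rewrite !hornerE.
    have : \prod_(i < m.+1 | i != j) (x - z i) != 0 by apply/prodf_neq0.
    rewrite /t; move: (\prod_(_ | _) _) (xz0 j) => p ? ?.
    by field; apply/andP.
  by rewrite o0 mulr0.
have tgt i : 0 < t i + (t i)^*.
  (* For |z i| = 1, twice the real part of x / (x - z i) is 1 + (|x|^2 - 1) / |x - z i|^2. *)
  have e : t i + (t i)^* = (`|x| ^+ 2 - 1 + `|x - z i| ^+ 2) / `|x - z i| ^+ 2.
    rewrite !normCK /t rmorphM /= fmorphV /= rmorphB /=.
    have c0 : x^* - (z i)^* != 0 by rewrite -rmorphB conjC_eq0.
    have := norm1_conj (z1 i) => zz.
    have -> : x * x^* - 1 = x * x^* - z i * (z i)^* by rewrite zz.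
    by field; rewrite xz0 c0.
  rewrite e divr_gt0 ?exprn_gt0 ?normr_gt0 // ltr_wpDl ?exprn_gt0 ?normr_gt0 //.
  by rewrite subr_ge0 exprn_ege1.
have : 0 < \sum_i w i * (t i + (t i)^*).
  rewrite big_ord_recl ltr_pwDl ?mulr_gt0 // sumr_ge0 // => i _.
  by rewrite ltW ?mulr_gt0.
have -> : \sum_i w i * (t i + (t i)^*) = \sum_i w i * t i + (\sum_i w i * t i)^*.
  rewrite rmorph_sum -big_split; apply: eq_bigr => i _ /=.
  by rewrite [(w i * t i)^*]rmorphM /= (conj_Creal (gtr0_real (w_gt0 i))) mulrDr.
by rewrite st rmorph0 addr0 ltxx.
Qed.

Lemma para_beta_prod : para_beta^* = - \prod_(i < m.+1) - z i.
Proof.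
rewrite rmorphN rmorph_prod; congr (- _); apply: eq_bigr => i _.
by rewrite rmorphN /= conjCK.
Qed.

Lemma norm_para_beta : `|para_beta| = 1.
Proof.
rewrite normrN normr_prod big1 // => i _.
by rewrite normrN norm_conjC z1.
Qed.

(** On the circle the reversal of X - z i is - conj(z i) (X - z i); the scalars for i different from
    j multiply to [para_beta] times z j. *)
Lemma revp_opuc : revp m opuc =
  \sum_(j < m.+1) (para_beta * w j * z j) *: \prod_(i < m.+1 | i != j) ('X - (z i)%:P).
Proof.
have [_ so] := opuc_monic.
apply: poly_eq_nonzero => x x0; rewrite horner_revp ?so //.
rewrite !horner_sum rmorph_sum mulr_sumr; apply: eq_bigr => j _ /=.
rewrite !hornerZ !horner_prod_cond rmorphM /= rmorph_prod.
rewrite (conj_Creal (gtr0_real (w_gt0 j))) mulrCA -!mulrA [RHS]mulrCA; congr (_ * _).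
have -> : x ^+ m = \prod_(i < m.+1 | i != j) x.
  rewrite prodr_const; congr (_ ^+ _); have := cardC1 j; rewrite card_ord /= => E.
  by apply: (etrans (esym E)); apply: eq_card => i; rewrite !inE.
have -> : para_beta * (z j * \prod_(i < m.+1 | i != j) ('X - (z i)%:P).[x]) =
   (z j * (z j)^*) * \prod_(i < m.+1 | i != j) (- (z i)^* * ('X - (z i)%:P).[x]).
  by rewrite /para_beta (bigD1 j) //= big_split /=; ring.
rewrite norm1_conj // mul1r -big_split; apply: eq_bigr => i _ /=.
rewrite !hornerE rmorphB /= fmorphV /= conjCK mulrBr divff // mulrBr.
by rewrite mulNr [_^* * _]mulrC -[X in X - _](norm1_conj (z1 i)); ring.
Qed.

Lemma opuc_para : 'X * opuc - para_beta^* *: revp m opuc = \prod_(i < m.+1) ('X - (z i)%:P).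
Proof.
have bb := norm1_conj norm_para_beta.
rewrite revp_opuc scaler_sumr mulr_sumr -sumrB.
rewrite -[RHS]scale1r -w_sum1 scaler_suml; apply: eq_bigr => j _.
rewrite [X in _ = _ *: X](bigD1 j) //= scalerA.
have -> : para_beta^* * (para_beta * w j * z j) = w j * z j.
  by rewrite -[RHS]mul1r -bb; ring.
by rewrite -!mul_polyC polyCM; ring.
Qed.

End Weights.

(* The number B of the paper. *)
Definition para_link al b1 b2 : C := b1^* * b2 * (1 - b2^* * al) / (1 - b2 * al^*).

Lemma one_sub_neq0 (b al : C) : `|b| = 1 -> `|al| < 1 -> 1 - b * al^* != 0.
Proof.
move=> b1 a1; rewrite subr_eq0; apply: contraTneq a1 => /(congr1 Num.norm).
by rewrite normrM b1 norm_conjC normr1 mul1r => <-; rewrite ltxx.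
Qed.

Lemma parapolyS a b1 b2 m : `|b2| = 1 -> `|a m| < 1 ->
  parapoly a b1 m.+1 = ('X + (b1^* * a m)%:P) * parapoly a b2 m +
    (b2^* * (1 - b2 * (a m)^*)) *: (('X - (para_link (a m) b1 b2)%:P) * (szego a m).2).
Proof.
move=> b2N am; set al := a m; set z := para_link al b1 b2.
have bb := norm1_conj b2N; have d0 := one_sub_neq0 b2N am.
have c1 : b2^* * (1 - b2 * al^*) = b2^* - al^*.
  by rewrite mulrBr mulr1 mulrA [_^* * b2]mulrC bb mul1r.
(* Replacing X Phi by p2 + conj b2 Phi* leaves a linear factor in front of Phi*, and [z] is its
   root. *)
have c2 : (b2^* - al^*) * z = b1^* * (1 - b2^* * al).
  transitivity (b2 * b2^* * (b1^* * (1 - b2^* * al))); last by rewrite bb mul1r.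
  by rewrite -c1 /z /para_link; move: (1 - b2 * _) d0 => d d0; field.
rewrite c1 mulrBl scalerBr -!mul_polyC [X in _ - X]mulrA -polyCM c2.
rewrite /parapoly /= -/al -!mul_polyC !(polyCM, polyCB, polyC1); ring.
Qed.

Lemma parapoly_pair_inj m a a' (b1 b1' b2 b2' : C) :
  (forall j, (j < m.+1)%N -> `|a j| < 1) -> (forall j, (j < m.+1)%N -> `|a' j| < 1) ->
  `|b2| = 1 -> `|b1| = 1 ->
  parapoly a b1 m.+1 = parapoly a' b1' m.+1 -> parapoly a b2 m = parapoly a' b2' m ->
  para_link (a m) b1 b2 = para_link (a' m) b1' b2' ->
  (parapoly a b2 m).[para_link (a m) b1 b2] != 0 ->
  [/\ b1 = b1', b2 = b2' & forall j, (j < m.+1)%N -> a j = a' j].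
Proof.
move=> a1 a1' b2N b1N E1 E2 Ez pz.
have Eb c c' k : parapoly a c k = parapoly a' c' k -> c = c'.
  move=> /(congr1 (fun p => p.[0])); rewrite !parapoly0 => /oppr_inj.
  exact: (can_inj conjCK).
have b1E := Eb _ _ _ E1; have b2E := Eb _ _ _ E2; subst b1' b2'.
split=> //.
have H := parapolyS b1 b2N (a1 m (ltnSn m)).
have H' := parapolyS b1 b2N (a1' m (ltnSn m)).
rewrite -Ez -E1 -E2 in H'; set z := para_link _ _ _ in pz H H'.
(* At [z] the Phi* term drops out: p1(z) = (z + conj b1 a_m) p2(z), with p2(z) nonzero. *)
have am : a m = a' m.
  have ez (c k : C) (p q : {poly C}) :
      (('X + c%:P) * p + k *: (('X - z%:P) * q)).[z] = (z + c) * p.[z].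
    by rewrite hornerD hornerZ !hornerM hornerD hornerX hornerC hornerXsubC subrr; ring.
  have := congr1 (fun p => p.[z]) H; rewrite H' !ez.
  move/(mulIf pz)/addrI/esym; apply: mulfI.
  by rewrite conjC_eq0 -normr_gt0 b1N ltr01.
have E2' : (szego a m).2 = (szego a' m).2.
  rewrite H -am in H'; move/addrI: H'.
  have d0 : b2^* * (1 - b2 * (a m)^*) != 0.
    by rewrite mulf_neq0 ?one_sub_neq0 ?a1 // conjC_eq0 -normr_gt0 b2N ltr01.
  by move/(scalerI d0)/(mulfI _); apply; rewrite polyXsubC_eq0.
have ES : szego a m = szego a' m.
  rewrite [LHS]surjective_pairing [RHS]surjective_pairing E2'; congr pair.
  move: E2; rewrite /parapoly E2' => /addIr; apply: mulfI.
  exact: monic_neq0 (monicX C).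
move=> j; rewrite ltnS leq_eqVlt => /predU1P[->//|jm].
by apply: (szego_inj _ ES) => // i im; apply: a1; lia.
Qed.

End OPUC.

(** * Existence of the coefficients from positive weights *)

Section Existence.
Variable C : numClosedFieldType.

(** Interlacing enters only through r and k. The nodes y are the intended zeros of p2 followed by
    zeta, at [ord_max]. *)
Lemma parapoly_pair_exists m (x y r : 'I_m.+2 -> C) (k : C) :
  injective y -> (forall i, `|x i| = 1) -> (forall i, `|y i| = 1) ->
  (forall i, 0 < r i) -> `|k| = 1 ->
  k ^+ 2 * \prod_i - y i = - \prod_i - x i ->
  (forall j, \prod_i (y j - x i) =
     2 * k * r j * y j * \prod_(i < m.+2 | i != j) (y j - y i)) ->
  exists (a : nat -> C) (b1 b2 : C),
    [/\ forall j, (j < m.+1)%N -> `|a j| < 1, `|b1| = 1 /\ `|b2| = 1,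
        parapoly a b1 m.+1 = \prod_i ('X - (x i)%:P),
        parapoly a b2 m = \prod_(i < m.+1) ('X - (y (widen_ord (leqnSn _) i))%:P) &
        para_link (a m) b1 b2 = y ord_max].
Proof.
move=> y_inj x1 y1 r_gt0 k1 kxy yx.
have kk := norm1_conj k1.
set p1 := \prod_i ('X - (x i)%:P).
have p1m : p1 \is monic by apply: monic_prod_XsubC.
have p1s : size p1 = m.+3 by rewrite size_prod_XsubC /index_enum -enumT size_enum_ord.
have y0 i : y i != 0 by rewrite -normr_gt0 y1 ltr01.
have p10 : p1.[0] = \prod_i - x i.
  by rewrite horner_prod_cond; apply: eq_bigr => i _; rewrite !hornerE.
have p1y j : p1.[y j] = 2 * k * r j * y j * \prod_(i < m.+2 | i != j) (y j - y i).
  by rewrite -yx horner_prod_cond; apply: eq_bigr => i _; rewrite !hornerE.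
pose z i := y (widen_ord (leqnSn m.+1) i); pose u i := r (widen_ord (leqnSn m.+1) i).
have z_inj : injective z.
  by move=> i j /y_inj /(congr1 val) /= /val_inj.
have z1 i : `|z i| = 1 by exact: y1.
set S := \sum_i u i; set rN := r ord_max.
have u_gt0 i : 0 < u i by exact: r_gt0.
have S_gt0 : 0 < S by rewrite /S big_ord_recl ltr_pwDl // sumr_ge0 // => i _; rewrite ltW.
have S0 : S != 0 by rewrite gt_eqF.
have rN_gt0 : 0 < rN by exact: r_gt0.
(* Two expressions for p1(0): the Lagrange sum over the nodes y, and [kxy]. *)
have sumk : 2 * k * (S + rN) = 1 + k ^+ 2.
  have := sum_lagrange_coef y_inj p1m p1s y0 p1y.
  have P0 : \prod_i - y i != 0 by apply/prodf_neq0 => i _; rewrite oppr_eq0.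
  have -> : p1.[0] = \prod_i - y i * - k ^+ 2 by rewrite mulrN mulrC kxy opprK.
  move=> /(mulfI P0); rewrite -mulr_sumr big_ord_recr /= -/S -/rN => E.
  by rewrite -[k ^+ 2]opprK E; ring.
have sumc : 2 * (S + rN) = k + k^*.
  have k0 : k != 0 by rewrite -normr_gt0 k1.
  apply: (mulfI k0); rewrite [RHS]mulrDr kk mulrA [k * 2]mulrC sumk; ring.
have Sc : S^* = S by apply: conj_Creal; apply: gtr0_real.
pose w i := u i / S.
have w_gt0 i : 0 < w i by rewrite divr_gt0.
have w_sum1 : \sum_i w i = 1 by rewrite -mulr_suml divff.
pose b2 := para_beta z; have b2N : `|b2| = 1 by exact: norm_para_beta.
pose b1 := - (\prod_i - x i)^*.
have b1N : `|b1| = 1.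
  by rewrite normrN norm_conjC normr_prod big1 // => i _; rewrite normrN x1.
(* The identity of [parapolyS] at z i forces (1 - b2 conj al) w i = 2 k u i; summing over i gives 1
   - b2 conj al = s. *)
pose s := 2 * k * S; pose al := b2 * (1 - s^*).
have bb := norm1_conj b2N.
have sc : s^* = 2 * k^* * S by rewrite /s !rmorphM /= Sc rmorph_nat.
(* By [sumc], 1 - |al|^2 reduces to 4 S rN, positive because zeta carries positive weight too. *)
have al1 : `|al| < 1.
  rewrite normrM b2N mul1r -(ltr_pXn2r (n := 2)) ?nnegrE // expr1n normCK.
  rewrite rmorphB rmorph1 /= conjCK sc /s -subr_gt0.
  have -> : 1 - (1 - 2 * k^* * S) * (1 - 2 * k * S) =
    2 * S * (k + k^*) - 4 * (k * k^*) * S ^+ 2 by ring.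
  rewrite kk -sumc; have -> : 2 * S * (2 * (S + rN)) - 4 * 1 * S ^+ 2 = 4 * S * rN by ring.
  by rewrite !mulr_gt0.
have [om os] := opuc_monic z w_sum1.
have [a a1 aE] := schur_cohn om os (opuc_neq0 z_inj z1 w_gt0).
pose a' j := if j == m then al else a j.
have a'm : a' m = al by rewrite /a' eqxx.
have a'1 j : (j < m.+1)%N -> `|a' j| < 1.
  by rewrite /a'; case: eqVneq => // jm jm'; apply: a1; lia.
have a'E : szego a' m = (opuc z w, revp m (opuc z w)).
  by rewrite -aE; apply: eq_szego => j jm; rewrite /a'; case: eqVneq => // jm'; lia.
have P2 : parapoly a' b2 m = \prod_i ('X - (z i)%:P).
  by rewrite /parapoly a'E /=; apply: opuc_para.
have b12 : b1^* * b2 = k ^+ 2 * y ord_max.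
  have -> : b1^* = - \prod_i - x i by rewrite /b1 rmorphN /= conjCK.
  rewrite -kxy big_ord_recr /= -/z.
  have := para_beta_prod z; rewrite -/b2 => E.
  have -> : \prod_(i < m.+1) - y (widen_ord (leqnSn m.+1) i) = - b2^* by rewrite E opprK.
  have -> : k ^+ 2 * (- b2^* * - y ord_max) * b2 = k ^+ 2 * y ord_max * (b2 * b2^*) by ring.
  by rewrite bb mulr1.
have e1 : 1 - b2^* * al = s^*.
  by rewrite /al mulrA [b2^* * _]mulrC bb; ring.
have e2 : 1 - b2 * al^* = s.
  by rewrite /al rmorphM rmorphB rmorph1 /= conjCK mulrA bb; ring.
have k0 : k != 0 by rewrite -normr_gt0 k1.
have s0 : s != 0 by rewrite /s !mulf_neq0 // pnatr_eq0.
(* As s is a positive multiple of k, this collapses the quotient in [para_link] to zeta. *)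
have ks : k ^+ 2 * s^* = s.
  have -> : k ^+ 2 * s^* = 2 * k * S * (k * k^*) by rewrite sc; ring.
  by rewrite kk mulr1.
have link : para_link (a' m) b1 b2 = y ord_max.
  by rewrite /para_link a'm e1 e2 b12 [k ^+ 2 * _]mulrC -(mulrA (y ord_max)) ks mulfK.
exists a', b1, b2; split=> //.
have [pm ps] := parapoly_monic a' b1 m.+1.
(* Both sides are monic of degree m+2, so the m+2 nodes y suffice. *)
apply: (poly_eq_points y_inj); first by rewrite size_monic_sub.
move=> j; rewrite (parapolyS b1 b2N (a'1 m (ltnSn m))) link P2 a'E /= a'm e2 p1y.
rewrite hornerD hornerZ !hornerM hornerD hornerX hornerC hornerXsubC.
(* At z i the p2 term vanishes and Phi* supplies the weight; at zeta the Phi* term vanishes and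
   [sumk] turns the p2 term into 2 k rN. *)
case: (unliftP ord_max j) => [i ->|->].
  have -> : lift ord_max i = widen_ord (leqnSn m.+1) i by apply: val_inj; exact: lift_max.
  rewrite -/(z i) -/(u i).
  have -> : (\prod_i ('X - (z i)%:P)).[z i] = 0.
    by rewrite (bigD1 i) //= hornerM hornerXsubC subrr mul0r.
  have -> : \prod_(l < m.+2 | l != widen_ord (leqnSn m.+1) i) (z i - y l) =
      \prod_(l < m.+1 | l != i) (z i - z l) * (z i - y ord_max).
    rewrite big_mkcond big_ord_recr /= [in RHS]big_mkcond /=.
    have -> : ord_max != widen_ord (leqnSn m.+1) i.
      by rewrite -val_eqE /= neq_ltn ltn_ord orbT.
    by congr (_ * _); apply: eq_bigr => l _; rewrite -!val_eqE.
  rewrite mulr0 add0r (revp_opuc z1 w_gt0 w_sum1) horner_sum_prod_neq -/b2 /w.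
  move: (\prod_(_ | _) _) => T.
  have -> : b2^* * s * ((z i - y ord_max) * (b2 * (u i / S) * z i * T)) =
    (b2 * b2^*) * (s / S) * u i * z i * (T * (z i - y ord_max)) by ring.
  by rewrite bb mul1r /s mulfK.
rewrite subrr mul0r mulr0 addr0.
have -> : (\prod_i ('X - (z i)%:P)).[y ord_max] = \prod_(i < m.+2 | i != ord_max) (y ord_max - y i).
  rewrite horner_prod_cond [RHS]big_mkcond [RHS]big_ord_recr /= eqxx mulr1.
  apply: eq_bigr => i _; rewrite !hornerE.
  by have -> : widen_ord (leqnSn m.+1) i != ord_max by rewrite -val_eqE /= neq_ltn ltn_ord.
congr (_ * _).
have -> : b1^* * al = b1^* * b2 * (1 - s^*) by rewrite /al; ring.
rewrite b12 -/rN.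
have -> : y ord_max + k ^+ 2 * y ord_max * (1 - s^*) = y ord_max * (1 + k ^+ 2 - k ^+ 2 * s^*) by ring.
by rewrite ks -sumk /s; ring.
Qed.

End Existence.

(** * Spectrum of CMV matrices *)

Section CMVBlock.
Variable R : realType.
Local Notation C := R[i].
Implicit Types (a : nat -> C) (b z : C).

(** The quotient and remainder bookkeeping of [cmv_block] is resolved once, in terms of the start s
    of a genuine block. *)
Lemma cmv_block_entry p N a b (i j : 'I_N) (s : nat) :
  (p <= 1)%N -> ~~ odd (s + p) -> (s.+1 < N)%N -> (j == s :> nat) || (j == s.+1 :> nat) ->
  cmv_block p N a b i j =
  if i == s :> nat then theta_entry (a s) 0 (j - s)
  else if i == s.+1 :> nat then theta_entry (a s) 1 (j - s) else 0.
Proof.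
move=> p1 os sN js; rewrite mxE; cbv zeta.
have -> : ((i + p) %/ 2 == (j + p) %/ 2)%N = (i == s :> nat) || (i == s.+1 :> nat) by lia.
have [is_|is_] := eqVneq (nat_of_ord i) s.
  have -> : (((i + p) %/ 2).*2 - p)%N = s by lia.
  have -> : (p <= ((i + p) %/ 2).*2)%N by lia.
  rewrite sN /=.
  have -> : ((i + p) %% 2)%N = 0%N by lia.
  by have -> : ((j + p) %% 2)%N = (j - s)%N by lia.
have [is1|is1] := eqVneq (nat_of_ord i) s.+1 => /=.
  have -> : (((i + p) %/ 2).*2 - p)%N = s by lia.
  have -> : (p <= ((i + p) %/ 2).*2)%N by lia.
  rewrite sN /=.
  have -> : ((i + p) %% 2)%N = 1%N by lia.
  by have -> : ((j + p) %% 2)%N = (j - s)%N by lia.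
by have -> : (nat_of_ord i == j) = false by lia.
Qed.

Lemma cmv_block_pair p N a b (v : 'rV[C]_N) (s s' : 'I_N) :
  (p <= 1)%N -> ~~ odd (s + p) -> s' = s.+1 :> nat ->
  (v *m cmv_block p N a b) 0 s = v 0 s * Num.conj (a s) + v 0 s' * rho (a s) /\
  (v *m cmv_block p N a b) 0 s' = v 0 s * rho (a s) - v 0 s' * a s.
Proof.
move=> p1 os s's; have sN : (s.+1 < N)%N by rewrite -s's.
have ss' : s' != s by apply/eqP => /(congr1 val) /=; lia.
have aux (f : 'I_N -> C) : (forall i, i != s -> i != s' -> f i = 0) -> \sum_i f i = f s + f s'.
  move=> f0; rewrite (bigD1 s) //= (bigD1 s') //= big1 ?addr0 // => i /andP[? ?]; exact: f0.
split; rewrite mxE aux.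
- rewrite !(cmv_block_entry a b _ p1 os sN) ?eqxx ?s's ?eqxx ?orbT //.
  by rewrite subnn /= eqn_leq ltnn.
- move=> i is_ is'; rewrite (cmv_block_entry a b _ p1 os sN) ?eqxx //.
  by rewrite -s's !(inj_eq val_inj) (negPf is_) (negPf is') mulr0.
- rewrite !(cmv_block_entry a b _ p1 os sN) ?eqxx ?s's ?eqxx ?orbT //.
  by rewrite subSnn /= eqn_leq ltnn /= mulrN.
- move=> i is_ is'; rewrite (cmv_block_entry a b _ p1 os sN) ?s's ?eqxx ?orbT //.
  by rewrite -s's !(inj_eq val_inj) (negPf is_) (negPf is') mulr0.
Qed.

Lemma cmv_block_last p N a b (v : 'rV[C]_N) (s : 'I_N) :
  (p <= 1)%N -> ~~ odd (s + p) -> s.+1 = N ->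
  (v *m cmv_block p N a b) 0 s = v 0 s * Num.conj b.
Proof.
move=> p1 os sN; rewrite mxE (bigD1 s) //= big1 ?addr0 => [|i is_]; rewrite mxE; cbv zeta.
  have -> : ((((s + p) %/ 2).*2 - p).+1 < N)%N = false by lia.
  rewrite !andbF eqxx; have -> // : (s < p)%N = false by lia.
have iN := ltn_ord i; have is1 : nat_of_ord i <> s by move=> /val_inj /eqP; rewrite (negPf is_).
have -> : ((i + p) %/ 2 == (s + p) %/ 2)%N = false by lia.
by rewrite /= (negPf is_ : (i == s :> nat) = false) mulr0.
Qed.

Lemma cmvM_first N a b (v : 'rV[C]_N) (s : 'I_N) :
  s = 0%N :> nat -> (v *m cmvM N a b) 0 s = v 0 s.
Proof.
move=> s0; rewrite mxE (bigD1 s) //= big1 ?addr0 => [|i is_]; rewrite mxE s0 /=; cbv zeta.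
  by rewrite mulr1.
have is1 : nat_of_ord i <> 0%N by rewrite -s0 => /val_inj /eqP; rewrite (negPf is_).
have -> : ((i + 1) %/ 2 == (0 + 1) %/ 2)%N = false by lia.
by rewrite (introF eqP is1) mulr0.
Qed.
End CMVBlock.

Section CMVEigen.
Variable R : realType.
Local Notation C := R[i].
Implicit Types (a : nat -> C) (b z : C).

Lemma rho_neq0 (x : C) : `|x| < 1 -> rho x != 0.
Proof.
by move=> x1; rewrite sqrtC_eq0 gt_eqF // subr_gt0 expr_lt1.
Qed.

Lemma rho_sqr (x : C) : rho x ^+ 2 = 1 - x * x^*.
Proof. by rewrite sqrtCK normCK. Qed.

(** Each step divides by [rho], and a step through M, from an odd index, also by z; hence the
    exponent m./2. *)
Definition szego_scale a z m : C := (z ^+ m./2 * \prod_(j < m) rho (a j))^-1.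

(* The m-th entries (v_m, y_m) for the row vectors v and y = v L with v L M = z v,
   normalised by v_0 = 1; the roles of Phi and Phi* alternate with parity because the
   blocks of L and M start at even and odd indices respectively. *)
Definition szego_pair a z m : C * C :=
  let p := szego a m in
  let k := szego_scale a z m in
  if odd m then (k * p.1.[z], k * p.2.[z]) else (k * p.2.[z], k * z * p.1.[z]).

Lemma szego_scale_neq0 a z m : (forall j, (j < m)%N -> `|a j| < 1) -> z != 0 ->
  szego_scale a z m != 0.
Proof.
move=> a1 z0; rewrite invr_eq0 mulf_neq0 ?expf_neq0 //.
by rewrite prodf_seq_neq0; apply/allP => j _; rewrite /= rho_neq0 ?a1.
Qed.

(** As rho is nonzero and rho^2 = 1 - |al|^2, a block equation is solvable for the entries at its
    second index: the transfer step. *)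
Lemma theta_solve (al v v' y y' : C) : `|al| < 1 ->
  (y = v * al^* + v' * rho al /\ y' = v * rho al - v' * al) <->
  (v' = (y - al^* * v) / rho al /\ y' = (v - al * y) / rho al).
Proof.
move=> al1; have r0 := rho_neq0 al1; have r2 := rho_sqr al.
split=> -[e1 e2].
  split; first by rewrite e1; field.
  apply: (mulIf r0); rewrite divfK // e2 e1.
  have -> : (v * rho al - v' * al) * rho al = v * rho al ^+ 2 - al * v' * rho al by ring.
  by rewrite r2; ring.
have {}e1 : v' * rho al = y - al^* * v by rewrite e1 divfK.
split; first by rewrite e1; ring.
apply: (mulIf r0); rewrite e2 divfK //.
have -> : (v * rho al - v' * al) * rho al = v * rho al ^+ 2 - al * (v' * rho al) by ring.
by rewrite r2 e1; ring.
Qed.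

Lemma szego_scaleS a z m :
  szego_scale a z m.+1 =
  szego_scale a z m / rho (a m) / (if odd m then z else 1).
Proof.
rewrite /szego_scale big_ord_recr /= uphalf_half -!invfM; congr (_^-1).
by case: (odd m); rewrite ?add1n ?add0n ?exprS; ring.
Qed.

Lemma szego_pair0 a z : szego_pair a z 0 = (1, z).
Proof.
rewrite /szego_pair /szego_scale big_ord0 /= !hornerC !mulr1 expr0 invr1.
by rewrite mul1r.
Qed.

(** Both directions serve: an eigenvector must follow the Szego pair, and the pair satisfies the
    block equations. For odd m the block lies in M and sends y to z v. *)
Lemma szego_pairS a z m (c v v' y y' : C) : `|a m| < 1 -> z != 0 ->
  v = c * (szego_pair a z m).1 -> y = c * (szego_pair a z m).2 ->
  (v' = c * (szego_pair a z m.+1).1 /\ y' = c * (szego_pair a z m.+1).2) <->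
  if odd m then z * v = y * (a m)^* + y' * rho (a m) /\ z * v' = y * rho (a m) - y' * a m
  else y = v * (a m)^* + v' * rho (a m) /\ y' = v * rho (a m) - v' * a m.
Proof.
move=> am z0; have r0 := rho_neq0 am.
rewrite /szego_pair szego_scaleS /= !hornerE /=.
set k := szego_scale a z m; set A := (szego a m).1.[z]; set B := (szego a m).2.[z].
case: (odd m) => -> -> /=; rewrite theta_solve //.
  split=> -[e1 e2]; split.
  - by rewrite e2; field; rewrite ?r0 ?z0.
  - by rewrite e1; field; rewrite ?r0 ?z0.
  - by apply: (mulfI z0); rewrite e2; field; rewrite ?r0 ?z0.
  - by rewrite e1; field; rewrite ?r0 ?z0.
by rewrite !divr1; split=> -[-> ->]; split; field.
Qed.

(** The 2x2 blocks propagate the pair from index 0, so a left eigenvector is fixed by its first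
    entry; the trailing 1x1 block leaves one equation, the vanishing of [parapoly]. *)
Lemma eigenvalue_cmv N a b z : (forall j, (j < N)%N -> `|a j| < 1) -> z != 0 ->
  eigenvalue (cmv N.+1 a b) z = root (parapoly a b N) z.
Proof.
move=> a1 z0.
have kN0 : szego_scale a z N != 0 by exact: szego_scale_neq0.
(* The order being N+1, the trailing conj b lies in M when N is odd and in L when N is even. *)
have ends (c v y : C) : v = c * (szego_pair a z N).1 -> y = c * (szego_pair a z N).2 ->
    (if odd N then z * v = y * b^* else y = v * b^*) <-> c * (parapoly a b N).[z] = 0.
  rewrite /parapoly /szego_pair !hornerE /=; set k := szego_scale a z N.
  set A := _.1.[z]; set B := _.2.[z].
  have E (u w : C) : u - w = k * (c * (z * A - b^* * B)) -> (u = w <-> c * (z * A - b^* * B) = 0).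
    move=> uw; split=> [uw0|c0]; last by apply/eqP; rewrite -subr_eq0 uw c0 mulr0.
    by apply: (mulfI kN0); rewrite mulr0 -uw uw0 subrr.
  by case: (odd N) => /= -> ->; apply: E; ring.
apply/eigenvalueP/idP => [[v vC v0]|].
  set y := v *m cmvL N.+1 a b.
  have yM : y *m cmvM N.+1 a b = z *: v by rewrite -vC mulmxA.
  have H m (mN : (m < N.+1)%N) : v 0 (Ordinal mN) = v 0 ord0 * (szego_pair a z m).1 /\
      y 0 (Ordinal mN) = v 0 ord0 * (szego_pair a z m).2.
    elim: m mN => [|m IH] mN.
      have -> : Ordinal mN = ord0 by apply: val_inj.
      rewrite szego_pair0 mulr1.
      by split=> //; rewrite -(cmvM_first a b y (s := ord0)) // yM mxE mulrC.
    have mN' : (m < N.+1)%N by lia.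
    have [vm ym] := IH mN'; apply: (szego_pairS _ _ (a1 m mN) z0 vm ym).2.
    case: ifP => om.
      have [||//|] := @cmv_block_pair R 1 N.+1 a b y (Ordinal mN') (Ordinal mN); rewrite ?addn1 /= ?om //.
      by rewrite -/(cmvM _ _ _) yM !mxE.
    by have [||//|] := @cmv_block_pair R 0 N.+1 a b v (Ordinal mN') (Ordinal mN); rewrite ?addn0 /= ?om.
  have v00 : v 0 ord0 != 0.
    apply: contraNneq v0 => v00; apply/eqP/rowP => -[m mN].
    by have [-> _] := H m mN; rewrite v00 mul0r mxE.
  have [vN yN] := H N (ltnSn N).
  rewrite /root -(inj_eq (mulfI v00)) mulr0; apply/eqP; apply: (ends _ _ _ vN yN).1.
  case: ifP => oN.
    have := @cmv_block_last R 1 N.+1 a b y (Ordinal (ltnSn N)).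
    by rewrite -/(cmvM _ _ _) yM addn1 /= oN mxE; apply.
  by have := @cmv_block_last R 0 N.+1 a b v (Ordinal (ltnSn N)); rewrite addn0 /= oN; apply.
move=> /rootP pz.
pose v : 'rV[C]_N.+1 := \row_j (szego_pair a z j).1.
pose y : 'rV[C]_N.+1 := \row_j (szego_pair a z j).2.
have P m (mN : (m < N)%N) := (szego_pairS (c := 1) _ _ (a1 m mN) z0
   (esym (mul1r _)) (esym (mul1r _))).1 (conj (esym (mul1r _)) (esym (mul1r _))).
have E := (ends 1 _ _ (esym (mul1r _)) (esym (mul1r _))).2 (etrans (congr1 _ pz) (mulr0 1)).
have vL : v *m cmvL N.+1 a b = y.
  apply/rowP => -[m mN]; rewrite [RHS]mxE /=.
  (* In L an odd index ends a block; an even one starts a block or is the trailing index. *)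
  have [om|om] := boolP (odd m).
    case: m mN om => // m mN om; have mN' : (m < N.+1)%N by lia.
    have [||//|_ ->] := @cmv_block_pair R 0 N.+1 a b v (Ordinal mN') (Ordinal mN); rewrite ?addn0 //.
    by have := P m mN; rewrite (negPf (om : ~~ odd m)) => -[_]; rewrite !mxE.
  have [mN1|mN1] := ltnP m N.
    have mN' : (m.+1 < N.+1)%N by lia.
    have [||//|-> _] := @cmv_block_pair R 0 N.+1 a b v (Ordinal mN) (Ordinal mN'); rewrite ?addn0 //.
    by have := P m mN1; rewrite (negPf om) => -[]; rewrite !mxE.
  have mE : m = N by lia.
  subst m; rewrite cmv_block_last ?addn0 // mxE /=.
  by move: E; rewrite (negPf om).
have yM : y *m cmvM N.+1 a b = z *: v.
  apply/rowP => -[m mN]; rewrite [RHS]mxE [v 0 _]mxE /=.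
  (* In M the parities are exchanged, and index 0 carries the leading 1. *)
  have [om|om] := boolP (odd m); last first.
    case: m mN om => [|m] mN om.
      by rewrite cmvM_first // mxE szego_pair0 /= mulr1.
    have mN' : (m < N.+1)%N by lia.
    have [||//|_ ->] := @cmv_block_pair R 1 N.+1 a b y (Ordinal mN') (Ordinal mN); rewrite ?addn1 //.
    by rewrite /= negbK in om; have := P m mN; rewrite om => -[_]; rewrite !mxE.
  have [mN1|mN1] := ltnP m N.
    have mN' : (m.+1 < N.+1)%N by lia.
    have [||//|-> _] := @cmv_block_pair R 1 N.+1 a b y (Ordinal mN) (Ordinal mN'); rewrite ?addn1 /= ?om //.
    by have := P m mN1; rewrite om => -[]; rewrite !mxE.
  have mE : m = N by lia.
  subst m; rewrite cmv_block_last ?addn1 /= ?om // mxE /=.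
  by move: E; rewrite om.
exists v; first by rewrite mulmxA vL.
apply/eqP => /rowP /(_ ord0); rewrite !mxE szego_pair0 /=.
by apply/eqP/oner_neq0.
Qed.
End CMVEigen.

(** * Interlacing points on the circle *)

Section Circle.
Variable R : realType.
Local Notation C := R[i].
Implicit Types x y : R.

Lemma expiD x y : expi (x + y) = expi x * expi y :> C.
Proof. by rewrite /expi cosD sinD; simpc; congr (_ +i* _)%C; ring. Qed.

Lemma norm_expi x : `|expi x| = 1 :> C.
Proof. by rewrite normc_def /= cos2Dsin2 sqrtr1. Qed.

Lemma expi_neq0 x : expi x != 0 :> C.
Proof. by rewrite -normr_gt0 norm_expi ltr01. Qed.

Lemma expi_sqr x : expi (x / 2) ^+ 2 = expi x :> C.
Proof. by rewrite expr2 -expiD -splitr. Qed.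

Definition hsin x y : R := sin ((x - y) / 2).

(** Factoring out the midpoint phase leaves 2i times a real sine, which carries the sign
    information. *)
Lemma expi_sub x y :
  expi x - expi y = 2 * 'i%C * (hsin x y)%:C%C * (expi (x / 2) * expi (y / 2)) :> C.
Proof.
set d := (x - y) / 2; rewrite -expiD -mulrDl.
have -> : expi x = expi ((x + y) / 2) * expi d :> C by rewrite -expiD; congr expi; rewrite /d; field.
have -> : expi y = expi ((x + y) / 2) * expi (- d) :> C by rewrite -expiD; congr expi; rewrite /d; field.
rewrite -mulrBr mulrC; congr (_ * _).
rewrite /expi cosN sinN /hsin -/d; apply/eqP; rewrite eq_complex; simpc => /=.
by apply/eqP; ring.
Qed.

Lemma hsin_gt0 x y : y < x -> x < y + 2 * pi -> 0 < hsin x y.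
Proof. by move=> yx xy; apply: sin_gt0_pi; rewrite ?divr_gt0 ?subr_gt0 //; lra. Qed.

Lemma hsinC x y : hsin y x = - hsin x y.
Proof. by rewrite /hsin -sinN -mulNr opprB. Qed.

Lemma expi_neq x y : y < x -> x < y + 2 * pi -> expi x != expi y :> C.
Proof.
move=> yx xy; rewrite -subr_eq0 expi_sub !mulf_neq0 ?expi_neq0 ?pnatr_eq0 //.
  by rewrite complexiE neq0Ci.
by rewrite fmorph_eq0 gt_eqF // hsin_gt0.
Qed.

End Circle.

Section Interlacing.
Variable R : realType.
Local Notation C := R[i].
Variables (n : nat) (X Y : nat -> R).
Hypotheses (XY : forall j, (j < n)%N -> X j < Y j).
Hypotheses (YX : forall j, (j.+1 < n)%N -> Y j < X j.+1).
Hypothesis (YX0 : forall j, (j < n)%N -> Y j < X 0 + 2 * pi).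

Lemma interlace_leX i j : (i <= j)%N -> (j < n)%N -> X i <= X j.
Proof.
elim: j => [|j IH]; first by rewrite leqn0 => /eqP->.
rewrite leq_eqVlt => /predU1P[->//|ij] jn.
apply: (le_trans (IH ij (ltnW jn))); apply: ltW; apply: lt_trans (YX jn).
exact: XY (ltnW jn).
Qed.

Lemma interlace_XY i j : (i <= j)%N -> (j < n)%N -> X i < Y j.
Proof. by move=> ij jn; apply: le_lt_trans (XY jn); apply: interlace_leX. Qed.

Lemma interlace_YX i j : (j < i)%N -> (i < n)%N -> Y j < X i.
Proof.
move=> ji jn; apply: (lt_le_trans (YX (leq_ltn_trans ji jn))).
exact: interlace_leX.
Qed.

Lemma interlace_window i j : (i < n)%N -> (j < n)%N -> Y j < X i + 2 * pi.
Proof.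
move=> i_n j_n; apply: (lt_le_trans (YX0 j_n)); rewrite lerD2r.
exact: interlace_leX.
Qed.

Lemma interlace_ltY i j : (i < j)%N -> (j < n)%N -> Y i < Y j.
Proof. by move=> ij jn; apply: (lt_trans (interlace_YX ij jn)); apply: XY. Qed.

Lemma hsin_YX i j : (i <= j)%N -> (j < n)%N -> 0 < hsin (Y j) (X i).
Proof.
move=> ij jn; apply: hsin_gt0; first exact: interlace_XY.
by apply: interlace_window; lia.
Qed.

Lemma hsin_YX_lt i j : (j < i)%N -> (i < n)%N -> hsin (Y j) (X i) < 0.
Proof.
move=> ji i_n; rewrite hsinC oppr_lt0 hsin_gt0 ?interlace_YX //.
apply: (@le_lt_trans _ _ (Y i)); first by rewrite ltW ?XY.
apply: (lt_trans (@interlace_window 0 i _ i_n)); first by lia.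
by rewrite ltrD2r interlace_XY //; lia.
Qed.

Lemma hsin_YY i j : (i < j)%N -> (j < n)%N -> 0 < hsin (Y j) (Y i).
Proof.
move=> ij jn; apply: hsin_gt0; first exact: interlace_ltY.
by apply: (lt_trans (@interlace_window 0 j _ jn)); rewrite ?ltrD2r ?interlace_XY; lia.
Qed.

(** By interlacing both sines are positive for i < j and negative for i > j. *)
Lemma hsin_ratio_gt0 i j : i != j -> (i < n)%N -> (j < n)%N ->
  0 < hsin (Y j) (X i) / hsin (Y j) (Y i).
Proof.
rewrite neq_ltn => /orP[ij|ji] i_n j_n.
  by rewrite divr_gt0 ?hsin_YX ?hsin_YY // ltnW.
by rewrite nmulr_rgt0 ?hsin_YX_lt // invr_lt0 hsinC oppr_lt0 hsin_YY.
Qed.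

Lemma expiY_inj : injective (fun i : 'I_n => expi (Y i)).
Proof.
have aux (k l : 'I_n) : (k < l)%N -> expi (Y k) <> expi (Y l).
  move=> kl; apply/eqP; rewrite eq_sym expi_neq ?interlace_ltY //.
  apply: (lt_trans (@interlace_window 0 l _ (ltn_ord l))); first by case: (l) => /=; lia.
  by rewrite ltrD2r interlace_XY.
move=> i j /= Eij; apply: val_inj => /=.
by case: (ltngtP i j) => // [/aux/(_ Eij)|/aux/(_ (esym Eij))].
Qed.

Lemma expiX_inj : injective (fun i : 'I_n => expi (X i)).
Proof.
have aux (k l : 'I_n) : (k < l)%N -> expi (X k) <> expi (X l).
  move=> kl; apply/eqP; rewrite eq_sym expi_neq //.
    by apply: (lt_trans (XY (ltn_ord k))); apply: interlace_YX.
  by apply: (lt_trans (XY (ltn_ord l))); apply: interlace_window.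
move=> i j /= Eij; apply: val_inj => /=.
by case: (ltngtP i j) => // [/aux/(_ Eij)|/aux/(_ (esym Eij))].
Qed.

Definition interlace_weight (j : 'I_n) : R :=
  hsin (Y j) (X j) * \prod_(i < n | i != j) (hsin (Y j) (X i) / hsin (Y j) (Y i)).

(** The number k: the total phase left by [expi_sub] in the quotients of chords, common to all j. *)
Definition interlace_phase : C :=
  'i%C * \prod_(i < n) (expi (X i / 2) / expi (Y i / 2)).

Lemma interlace_weight_gt0 j : 0 < interlace_weight j.
Proof.
by rewrite mulr_gt0 ?hsin_YX // prodr_gt0 // => i ij; apply: hsin_ratio_gt0.
Qed.

Lemma norm_interlace_phase : `|interlace_phase| = 1.
Proof.
rewrite normrM complexiE normCi mul1r normr_prod big1 // => i _.
by rewrite normrM normfV !norm_expi divr1.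
Qed.

Lemma interlace_phase_sqr :
  interlace_phase ^+ 2 * \prod_(i < n) - expi (Y i) = - \prod_(i < n) - expi (X i).
Proof.
rewrite exprMn sqr_i mulN1r mulNr -prodrXl -big_split; congr (- _).
apply: eq_bigr => i _ /=; rewrite -(expi_sqr (Y i)) -(expi_sqr (X i)).
by field; exact: expi_neq0.
Qed.

(** For i different from j, the factor 2i and the phase of Y j cancel between the chords to X i and
    to Y i. The chord to X j supplies 2i and the extra [expi (Y j)]. *)
Lemma interlace_prod (j : 'I_n) :
  \prod_(i < n) (expi (Y j) - expi (X i)) =
  2 * interlace_phase * (interlace_weight j)%:C%C * expi (Y j) *
    \prod_(i < n | i != j) (expi (Y j) - expi (Y i)).
Proof.
rewrite /interlace_phase /interlace_weight rmorphM rmorph_prod /=.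
rewrite (bigD1 j) //= [X in 2 * ('i%C * X)](bigD1 j) //=.
have -> : \prod_(i < n | i != j) (expi (Y j) - expi (X i)) =
   \prod_(i < n | i != j) (expi (X i / 2) / expi (Y i / 2)) *
   \prod_(i < n | i != j) (hsin (Y j) (X i) / hsin (Y j) (Y i))%:C%C *
   \prod_(i < n | i != j) (expi (Y j) - expi (Y i)).
  rewrite -!big_split; apply: eq_bigr => i ij /=; rewrite !expi_sub rmorphM /= fmorphV /=.
  have h0 : (hsin (Y j) (Y i))%:C%C != 0 :> C.
    have := hsin_ratio_gt0 ij (ltn_ord i) (ltn_ord j).
    rewrite lt0r mulf_eq0 negb_or invr_eq0 => /andP[/andP[_ h] _].
    by rewrite fmorph_eq0.
  by field; rewrite h0 expi_neq0.
rewrite expi_sub.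
move: (\prod_(_ | _) _) (\prod_(_ | _) _) (\prod_(_ | _) _) => p q s.
by rewrite -(expi_sqr (Y j)); field; exact: expi_neq0.
Qed.

End Interlacing.

(** * Prescribed spectra and the inverse problem *)

Section Spectrum.
Variable R : realType.
Local Notation C := R[i].

Lemma eq_cmv N (a a' : nat -> C) (b : C) :
  (forall j, (j.+1 < N)%N -> a j = a' j) -> cmv N a b = cmv N a' b.
Proof.
move=> aa'; rewrite /cmv; congr (_ *m _); apply/matrixP => i j; rewrite !mxE; cbv zeta;
  by case: ifP => // /and3P[_ _ sN]; rewrite aa'.
Qed.

Lemma cmv_spectrum N (a : nat -> C) (b : C) (x : nat -> R) :
  (forall j, (j < N)%N -> `|a j| < 1) ->
  injective (fun i : 'I_N.+1 => expi (x i.+1)) ->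
  (forall z : C, eigenvalue (cmv N.+1 a b) z <->
     exists2 j, (1 <= j <= N.+1)%N & z = expi (x j)) <->
  parapoly a b N = \prod_(i < N.+1) ('X - (expi (x i.+1))%:P).
Proof.
move=> a1 x_inj.
have ex_ord (P : nat -> Prop) :
    (exists2 j, (1 <= j <= N.+1)%N & P j) <-> exists i : 'I_N.+1, P i.+1.
  split=> [[[|j] // jN Pj]|[i Pi]]; first by exists (Ordinal (jN : (j < N.+1)%N)).
  by exists i.+1 => //=; apply: ltn_ord.
split=> [H|H z].
  have [pm ps] := parapoly_monic a b N.
  apply: (monic_roots_prod x_inj) => // i.
  rewrite -(eigenvalue_cmv _ a1) ?expi_neq0 //; apply/H/ex_ord.
  by exists i.
have ev i : eigenvalue (cmv N.+1 a b) (expi (x (i : 'I_N.+1).+1)).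
  rewrite (eigenvalue_cmv _ a1) ?expi_neq0 // H.
  by rewrite /root horner_prod (bigD1 i) //= hornerXsubC subrr mul0r.
(* The N+1 distinct eigenvalues found exhaust the characteristic polynomial; this also excludes 0,
   which [eigenvalue_cmv] does not cover. *)
have cp := monic_roots_prod x_inj (char_poly_monic (cmv N.+1 a b)) (size_char_poly _).
rewrite ex_ord; split=> [|[i ->]]; last exact: ev.
rewrite eigenvalue_root_char cp => [|i]; last by rewrite -eigenvalue_root_char.
rewrite /root horner_prod => /prodf_eq0[i _]; rewrite hornerXsubC subr_eq0 => /eqP ->.
by exists i.
Qed.

End Spectrum.

(* x1 j = x_{j,1} (1 <= j <= n), x2 j = x_{j,2} (1 <= j <= n-1);
   zeta = e^{i t} with x_{n,1} < t < x_{1,1} + 2 pi. *)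
Theorem theorem5 (R : realType) (n : nat) (x1 x2 : nat -> R) (t : R) :
  (2 <= n)%N ->
  (forall j, (1 <= j <= n.-1)%N -> x1 j < x2 j /\ x2 j < x1 j.+1) ->
  x1 n < x1 1%N + 2 * pi ->
  x1 n < t -> t < x1 1%N + 2 * pi ->
  exists (C1 : 'M[R[i]]_n) (C2 : 'M[R[i]]_(n.-1)),
    cmv_pair_ok x1 x2 (expi t) C1 C2 /\
    (forall (D1 : 'M[R[i]]_n) (D2 : 'M[R[i]]_(n.-1)),
       cmv_pair_ok x1 x2 (expi t) D1 D2 -> D1 = C1 /\ D2 = C2).
Proof.
case: n => [|[|m]] // _ /= x12 x1n x1t tx1.
(* Indices now start at 0, and t is appended to the angles of Z_2, so that two families of m+2
   points interlace. *)
pose X i := x1 i.+1; pose Y i := if (i < m.+1)%N then x2 i.+1 else t.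
have XY j : (j < m.+2)%N -> X j < Y j.
  move=> jm2; rewrite /X /Y; case: ltnP => jm; first exact: (x12 j.+1 jm).1.
  by have -> : j = m.+1 by lia.
have YX j : (j.+1 < m.+2)%N -> Y j < X j.+1.
  by rewrite /X /Y ltnS => jm; rewrite jm; exact: (x12 j.+1 jm).2.
have YX0 j : (j < m.+2)%N -> Y j < X 0%N + 2 * pi.
  move=> jm; rewrite {1}/Y; case: ltnP => // jm1.
  have : Y j < X j.+1 by apply: YX.
  rewrite {1}/Y jm1 => /lt_trans; apply; apply: le_lt_trans x1n.
  exact: (interlace_leX XY YX).
pose x (i : 'I_m.+2) : R[i] := expi (X i); pose y (i : 'I_m.+2) : R[i] := expi (Y i).
have x_inj : injective x := expiX_inj XY YX YX0.
have y_inj : injective y := expiY_inj XY YX YX0.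
have ymax : y ord_max = expi t by rewrite /y /Y /= ltnn.
have yw (i : 'I_m.+1) : y (widen_ord (leqnSn _) i) = expi (x2 i.+1).
  by rewrite /y /Y /= ltn_ord.
have x2_inj : injective (fun i : 'I_m.+1 => expi (x2 i.+1) : R[i]).
  by move=> i j /=; rewrite -!yw => /y_inj /(congr1 val) /= /val_inj.
have p2E : \prod_(i < m.+1) ('X - (y (widen_ord (leqnSn _) i))%:P) =
    \prod_(i < m.+1) ('X - (expi (x2 i.+1))%:P).
  by apply: eq_bigr => i _; rewrite yw.
have [a [b1 [b2 [a1 [b1N b2N] P1 P2 link]]]] :=
  @parapoly_pair_exists R[i] m x y (fun j => (interlace_weight X Y j)%:C%C)
    (interlace_phase m.+2 X Y) y_inj (fun=> norm_expi _) (fun=> norm_expi _)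
    (fun j => etrans (ltcR _ _) (interlace_weight_gt0 XY YX YX0 j))
    (norm_interlace_phase _ _ _) (interlace_phase_sqr _ _ _)
    (interlace_prod XY YX YX0).
rewrite ymax in link; rewrite p2E in P2.
have a1' j : (j < m)%N -> `|a j| < 1 by move=> jm; apply: a1; lia.
exists (cmv m.+2 a b1), (cmv m.+1 a b2); split.
  exists a, b1, b2; split=> //.
  - exact/(cmv_spectrum b1 (x := x1) a1 x_inj).
  - exact/(cmv_spectrum b2 (x := x2) a1' x2_inj).
  by rewrite /cmvB subn2 /= -link.
move=> D1 D2 [a' [b1' [b2' [[c1 [b1'N b2'N]] [-> ->] S1 S2 zE]]]].
have c1' j : (j < m)%N -> `|a' j| < 1 by move=> jm; apply: c1 => /=; lia.
have Q1 := (cmv_spectrum b1' (x := x1) c1 x_inj).1 S1.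
have Q2 := (cmv_spectrum b2' (x := x2) c1' x2_inj).1 S2.
have link' : para_link (a' m) b1' b2' = expi t by rewrite zE /cmvB subn2.
have [||||e1 e2 ea] := @parapoly_pair_inj R[i] m a' a b1' b1 b2' b2 c1 a1 b2'N b1'N.
- by rewrite Q1 P1.
- by rewrite Q2 P2.
- by rewrite link link'.
(* As zeta differs from all points of Z_2, p2 does not vanish there. *)
- rewrite link' Q2 -p2E horner_prod; apply/prodf_neq0 => i _.
  rewrite hornerXsubC -ymax subr_eq0 (inj_eq y_inj) -val_eqE /=.
  by rewrite neq_ltn ltn_ord orbT.
by rewrite e1 e2; split; apply: eq_cmv => j jm; apply: ea; lia.
Qed.
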